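(* Let $K=(\mathcal V,\mathcal E)$ be a connected, locally finite graph with weights $c$ on vertices and $r$ on edges. If $K$ is $\chi$-complete, then the Gauß-Bonnet operator $D=d+\delta$, with domain $C_0^0(K)\oplus C_0^1(K)$, is essentially self-adjoint in the Hilbert space $\mathcal H=L_2(\mathcal V)\oplus L_2(\mathcal E)$.
   Context: A graph $K=(\mathcal V,\mathcal E)$ consists of a set $\mathcal V$ of vertices and a set $\mathcal E\subset\mathcal V\times\mathcal V$ of oriented edges, which is symmetric ($(v_1,v_2)\in\mathcal E\Rightarrow(v_2,v_1)\in\mathcal E$) and without loops ($(v,v)\notin\mathcal E$). For $e=(v_1,v_2)\in\mathcal E$ put $e^-=v_1$, $e^+=v_2$, $-e=(v_2,v_1)$. $K$ is connected if any two vertices are joined by a finite path of edges, and locally finite if each vertex belongs to finitely many edges. Weights: $c:\mathcal V\to(0,\infty)$ and $r:\mathcal E\to(0,\infty)$ with $r(-e)=r(e)$. $C^0(K)=\mathbb C^{\mathcal V}$; $C^1(K)=\{\varphi:\mathcal E\to\mathbb C:\ \varphi(-e)=-\varphi(e)\}$; $C_0^0(K)$, $C_0^1(K)$ are the subspaces of finitely supported elements. Inner products: $\langle f,g\rangle=\sum_{v\in\mathcal V}c(v)f(v)\overline{g(v)}$ and $\langle\varphi,\psi\rangle=\frac12\sum_{e\in\mathcal E}r(e)\varphi(e)\overline{\psi(e)}$; $L_2(\mathcal V)$, $L_2(\mathcal E)$ are the Hilbert spaces of elements of $C^0(K)$, $C^1(K)$ of finite norm. Operators: $d f(e)=f(e^+)-f(e^-)$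 and $\delta\varphi(x)=\frac{1}{c(x)}\sum_{e\in\mathcal E,\,e^+=x}r(e)\varphi(e)$ ($\delta$ is the formal adjoint of $d$). $D(f,\varphi)=(\delta\varphi,df)$ on $C_0^0(K)\oplus C_0^1(K)$. $K$ is $\chi$-complete if there is an increasing sequence of finite sets $(B_n)_{n\in\mathbb N}$ with $\mathcal V=\bigcup_n B_n$ and functions $\chi_n$ such that: (i) $\chi_n\in C_0^0(K)$, $0\le\chi_n\le1$; (ii) $v\in B_n\Rightarrow\chi_n(v)=1$; (iii) there is $C>0$ such that for all $n\in\mathbb N$ and $x\in\mathcal V$, $\frac{1}{c(x)}\sum_{e:\ e^+=x\text{ or }e^-=x}r(e)\,(d\chi_n(e))^2\le C$. *)

(* Defs.v *)
From mathcomp Require Import all_boot all_order all_algebra.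
From mathcomp Require Import complex.
From mathcomp Require Import boolp classical_sets functions cardinality fsbigop.
From mathcomp Require Import reals ereal numfun esum.

Set Implicit Arguments.
Unset Strict Implicit.
Unset Printing Implicit Defensive.

Import Order.TTheory GRing.Theory Num.Theory.

Local Open Scope classical_set_scope.
Local Open Scope ring_scope.
Local Open Scope complex_scope.

Record graph := Graph {
  vertex :> choiceType;
  adj : rel vertex;
  adj_sym : symmetric adj;
  adj_irr : irreflexive adj }.

Section Edges.
Variable K : graph.

Definition edge : Type := {e : K * K | adj e.1 e.2}.

Definition src (e : edge) : K := (val e).1.
Definition tgt (e : edge) : K := (val e).2.

Lemma adj_swap (e : edge) : adj (tgt e) (src e).
Proof. by rewrite adj_sym; exact: (valP e). Qed.

Definition opp_edge (e : edge) : edge := exist _ (tgt e, src e) (adj_swap e).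

Definition connected_graph : Prop :=
  forall x y : K, exists2 p : seq K, path (@adj K) x p & last x p = y.

Definition locally_finite : Prop :=
  forall x : K, finite_set [set e : edge | tgt e = x \/ src e = x].

End Edges.

(* The Hilbert space is a subset [H] of an ambient space [W], with inner product
   [ip] linear in its first argument. An operator is a function [T] on [W] of
   which only the restriction to the domain [dom] matters; graphs are subsets of
   [W * W]. In the partial order of [C], [0 < eps] makes [eps] real. *)
Section UnboundedOperators.
Variables (C : numClosedFieldType) (W : lmodType C).
Variables (H : set W) (ip : W -> W -> C).

Definition op_graph (dom : set W) (T : W -> W) : set (W * W) :=
  [set (u, T u) | u in dom].

Definition dense_in_space (A : set W) : Prop :=
  A `<=` H /\
  forall x, H x -> forall eps : C, 0 < eps ->
    exists2 u, A u & ip (x - u) (x - u) < eps.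

Definition graph_closure (G : set (W * W)) : set (W * W) :=
  [set p | [/\ H p.1, H p.2 &
     forall eps : C, 0 < eps -> exists2 q, G q &
       ip (p.1 - q.1) (p.1 - q.1) + ip (p.2 - q.2) (p.2 - q.2) < eps]].

Definition graph_adjoint (G : set (W * W)) : set (W * W) :=
  [set p | [/\ H p.1, H p.2 &
     forall q, G q -> ip q.2 p.1 = ip q.1 p.2]].

Definition single_valued (G : set (W * W)) : Prop :=
  forall x y z, G (x, y) -> G (x, z) -> y = z.

Definition selfadjoint_graph (G : set (W * W)) : Prop :=
  [/\ single_valued G, dense_in_space [set p.1 | p in G]
    & graph_adjoint G = G].

Definition linear_operator (dom : set W) (T : W -> W) : Prop :=
  [/\ dom `<=` H, dom 0, {homo T : x / dom x >-> H x} &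
     forall (a : C) (u v : W), dom u -> dom v ->
       dom (a *: u + v) /\ T (a *: u + v) = a *: T u + T v].

Definition symmetric_operator (dom : set W) (T : W -> W) : Prop :=
  forall u v, dom u -> dom v -> ip (T u) v = ip u (T v).

(* Symmetric, with self-adjoint closure. *)
Definition essentially_selfadjoint (dom : set W) (T : W -> W) : Prop :=
  [/\ linear_operator dom T, dense_in_space dom, symmetric_operator dom T
    & selfadjoint_graph (graph_closure (op_graph dom T))].

End UnboundedOperators.

Section Summation.
Variables (R : realType) (I : choiceType).

(* Unordered sum of an absolutely summable family: positive part minus negative
   part, then componentwise over the complex numbers. It is a junk value for
   other families; products of two elements of an L2 space are summable. *)
Definition rsum (a : I -> R) : R :=
  fine (esum [set: I] (EFin \o a)^\+%E) - fine (esum [set: I] (EFin \o a)^\-%E).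

Definition csum (z : I -> R[i]) : R[i] :=
  rsum (fun i => complex.Re (z i)) +i* rsum (fun i => complex.Im (z i)).

End Summation.

Definition finitely_supported (I : Type) (U : zmodType) (f : I -> U) : Prop :=
  finite_set [set i | f i != 0].

Section WeightedGraph.
Variables (R : realType) (K : graph) (c : K -> R) (r : edge K -> R).

(* [R[i]^o] is [R[i]] as a vector space over itself. Elements of [Cochain1]
   are arbitrary functions on oriented edges;
   C^1(K) is the subspace [antisymmetric1]. *)
Definition Cochain0 : Type := K -> R[i]^o.
Definition Cochain1 : Type := edge K -> R[i]^o.

Definition antisymmetric1 (phi : Cochain1) : Prop :=
  forall e, phi (opp_edge e) = - phi e.

Definition differential (U : zmodType) (f : K -> U) (e : edge K) : U :=
  f (tgt e) - f (src e).

Definition codifferential (phi : Cochain1) : Cochain0 := fun x =>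
  (c x)^-1%:C * \sum_(e \in [set e | tgt e = x]) (r e)%:C * phi e.

Definition ip0 (f g : Cochain0) : R[i] :=
  csum (fun v => (c v)%:C * f v * (g v)^*).

Definition ip1 (phi psi : Cochain1) : R[i] :=
  2^-1 * csum (fun e => (r e)%:C * phi e * (psi e)^*).

Definition L2V : set Cochain0 := [set f |
  (\esum_(v in [set: K]) (c v * Normc.normc (f v) ^+ 2)%:E < +oo)%E].

Definition L2E : set Cochain1 := [set phi | antisymmetric1 phi /\
  (\esum_(e in [set: edge K]) (2^-1 * (r e * Normc.normc (phi e) ^+ 2))%:E < +oo)%E].

Definition Cochains : Type := (Cochain0 * Cochain1)%type.

Definition hilbert_sum : set Cochains := [set p | L2V p.1 /\ L2E p.2].

Definition ip_sum (p q : Cochains) : R[i] := ip0 p.1 q.1 + ip1 p.2 q.2.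

Definition gauss_bonnet (p : Cochains) : Cochains :=
  (codifferential p.2, differential p.1).

Definition gauss_bonnet_domain : set Cochains :=
  [set p | [/\ finitely_supported p.1, finitely_supported p.2
             & antisymmetric1 p.2]].

Definition chi_complete : Prop :=
  exists (B : nat -> set K) (chi : nat -> K -> R),
  [/\ [/\ forall n, finite_set (B n),
          {homo B : m n / (m <= n)%N >-> m `<=` n}
        & \bigcup_n B n = [set: K]],
      (forall n, finitely_supported (chi n) /\
                 forall v, 0 <= chi n v <= 1),
      (forall n v, B n v -> chi n v = 1)
    & exists2 M : R, 0 < M & forall n x,
        (c x)^-1 * \sum_(e \in [set e | tgt e = x \/ src e = x])
                     r e * differential (chi n) e ^+ 2 <= M].

End WeightedGraph.

(* Main.v *)
(* Let M be the graph of the maximal operator: pairs (x, Dx) with x and the formal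
   image Dx both in H. The closure and the adjoint of the graph of D both equal M:
   - Green's formula, valid as soon as one side is finitely supported, together
     with test elements supported at a vertex or on an edge, shows that a
     functional identity <Du, x> = <u, y> for all u in the domain forces y = Dx;
   - conversely (x, Dx) in M is approximated by cutting x = (f, phi) off to
     (chi_n f, m_n phi), where m_n is the mean of chi_n over the ends of an edge.
     The commutator of D with the cutoff has the two components
       f(e+) dchi_n(e)   and   (2c(x))^-1 sum_{e+ = x} r(e) dchi_n(e) phi(e),
     which are dominated through the chi-completeness bound (after summing over
     the edges ending at x, and by Cauchy-Schwarz), and vanish at each vertex for
     n large; hence they tend to 0 in norm by dominated convergence. *)

Require Import Defs.
From mathcomp Require Import all_boot all_order all_algebra.
From mathcomp Require Import complex.
From mathcomp Require Import boolp classical_sets functions reals.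
From mathcomp Require Import cardinality fsbigop ereal numfun esum.
From mathcomp Require Import ring lra.

Set Implicit Arguments.
Unset Strict Implicit.
Unset Printing Implicit Defensive.

Import Order.TTheory GRing.Theory Num.Theory.
Local Open Scope ring_scope.

(** * Unordered real sums *)

Section RealSums.
Variables (R : realType).
Implicit Type I : choiceType.
Local Open Scope classical_set_scope.

Definition rsummable I (a : I -> R) := summable [set: I] (EFin \o a).

Lemma rsummableD I (a b : I -> R) : rsummable a -> rsummable b ->
  rsummable (fun i => a i + b i).
Proof. exact: summableD. Qed.

Lemma rsummableN I (a : I -> R) : rsummable a -> rsummable (fun i => - a i).
Proof. by rewrite /rsummable summableN. Qed.

Lemma rsummable_norm I (a : I -> R) : rsummable a -> rsummable (fun i => `|a i|).
Proof. by rewrite /rsummable /summable; under eq_esum do rewrite -abse_id. Qed.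

Lemma rsummable_le I (a b : I -> R) : (forall i, `|a i| <= b i) ->
  rsummable b -> rsummable a.
Proof.
move=> ab; apply: le_lt_trans; apply: le_esum => i _ /=.
by rewrite lee_fin (le_trans (ab i))// ler_norm.
Qed.

Lemma rsummable_ge0P I (a : I -> R) : (forall i, 0 <= a i) ->
  rsummable a <-> (\esum_(i in [set: I]) (a i)%:E < +oo)%E.
Proof.
move=> a0; rewrite /rsummable /summable.
by under eq_esum do rewrite /= ger0_norm//.
Qed.

Lemma rsum_ge0E I (a : I -> R) : (forall i, 0 <= a i) -> rsummable a ->
  (rsum a)%:E = \esum_(i in [set: I]) (a i)%:E.
Proof.
move=> a0 /(rsummable_ge0P a0) sa; rewrite /rsum.
rewrite [X in _ - fine X](_ : _ = 0%E); last first.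
  apply: esum1 => i _; rewrite funenegE /= -EFin_max.
  by congr EFin; rewrite max_r// oppr_le0.
rewrite subr0 (_ : esum _ _ = \esum_(i in [set: I]) (a i)%:E); last first.
  apply: eq_esum => i _; rewrite funeposE /= -EFin_max.
  by congr EFin; rewrite max_l.
rewrite fineK// ge0_fin_numE// esum_ge0// => i _; by rewrite lee_fin.
Qed.

Lemma eq_rsum I (a b : I -> R) : a =1 b -> rsum a = rsum b.
Proof. by move=> /funext ->. Qed.

(** Any splitting of a family as a difference of nonnegative summable ones computes its [rsum], not
    only the splitting into positive and negative parts. Additivity rests on this freedom. *)
Lemma rsumB_ge0 I (a b : I -> R) : (forall i, 0 <= a i) -> (forall i, 0 <= b i) ->
  rsummable a -> rsummable b ->
  rsum (fun i => a i - b i) = rsum a - rsum b.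
Proof.
move=> a0 b0 sa sb.
have sab : rsummable (fun i => a i - b i) by apply: rsummableD => //; exact: rsummableN.
apply: EFin_inj; rewrite [RHS]EFinB (rsum_ge0E a0 sa) (rsum_ge0E b0 sb).
rewrite -(@esumB R I setT (EFin \o a) (EFin \o b))//; last first.
  by move=> i _; rewrite lee_fin.
  by move=> i _; rewrite lee_fin.
rewrite /rsum EFinB.
have fin f : summable [set: I] f -> (forall i, 0 <= f i)%E -> esum [set: I] f \is a fin_num.
  move=> sf f0; rewrite ge0_fin_numE; last by apply: esum_ge0.
  by apply: le_lt_trans sf; apply: le_esum => i _; rewrite gee0_abs.
rewrite !fineK//; apply: fin.
- exact: summable_funeneg.
- by move=> i; exact: funeneg_ge0.
- exact: summable_funepos.
- by move=> i; exact: funepos_ge0.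
Qed.

Lemma rsumD I (a b : I -> R) : rsummable a -> rsummable b ->
  rsum (fun i => a i + b i) = rsum a + rsum b.
Proof.
move=> sa sb.
(* Positive and negative parts. The family [p a + p b] is in general not the positive part of
   [a + b], but its difference with [n a + n b] is still an admissible splitting. *)
pose p (c : I -> R) i := (`|c i| + c i) / 2; pose n (c : I -> R) i := (`|c i| - c i) / 2.
have pn c i : c i = p c i - n c i by rewrite /p /n; lra.
have p0 c i : 0 <= p c i by rewrite /p; have := ler_norm (- c i); rewrite normrN; lra.
have n0 c i : 0 <= n c i by rewrite /n; have := ler_norm (c i); lra.
have sp c : rsummable c -> rsummable (p c).
  move=> sc; apply: (rsummable_le _ (rsummable_norm sc)) => i.
  by rewrite ger0_norm// /p; have := ler_norm (c i); lra.
have sn c : rsummable c -> rsummable (n c).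
  move=> sc; apply: (rsummable_le _ (rsummable_norm sc)) => i.
  by rewrite ger0_norm// /n; have := ler_norm (- c i); rewrite normrN; lra.
have addge0 (c d : I -> R) : (forall i, 0 <= c i) -> (forall i, 0 <= d i) ->
    rsummable c -> rsummable d ->
    rsum (fun i => c i + d i) = rsum c + rsum d.
  move=> c0 d0 sc sd.
    have cd0 i : 0 <= c i + d i by rewrite addr_ge0.
    apply: EFin_inj; rewrite [RHS]EFinD (rsum_ge0E c0 sc) (rsum_ge0E d0 sd).
    rewrite (rsum_ge0E cd0 (rsummableD sc sd)) -esumD// => i _; by rewrite lee_fin.
transitivity (rsum (fun i => (p a i + p b i) - (n a i + n b i))).
  by apply: eq_rsum => i; rewrite {1}(pn a) {1}(pn b); lra.
rewrite rsumB_ge0//; [| | | exact: rsummableD (sp _ sa) (sp _ sb)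
  | exact: rsummableD (sn _ sa) (sn _ sb)]; [|by move=> i; rewrite addr_ge0..].
rewrite !addge0//; [|by auto..].
rewrite [in RHS](eq_rsum (pn a)) [in RHS](eq_rsum (pn b)) !rsumB_ge0//; by [auto|lra].
Qed.

Lemma rsumN I (a : I -> R) : rsum (fun i => - a i) = - rsum a.
Proof.
rewrite /rsum opprB; congr (fine _ - fine _); apply: eq_esum => i _.
  by rewrite funeposE funenegE.
by rewrite funeposE funenegE /= opprK.
Qed.

Lemma rsum0 I : rsum (fun _ : I => 0) = 0 :> R.
Proof.
have := rsumN (fun _ : I => 0).
by rewrite (eq_rsum (b := fun=> 0)) => [|i]; [lra|exact: oppr0].
Qed.

Lemma rsumB I (a b : I -> R) : rsummable a -> rsummable b ->
  rsum (fun i => a i - b i) = rsum a - rsum b.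
Proof. by move=> sa sb; rewrite rsumD ?rsumN//; exact: rsummableN. Qed.

Lemma rsum_ge0 I (a : I -> R) : (forall i, 0 <= a i) -> 0 <= rsum a.
Proof.
move=> a0; have [sa|nsa] := pselect (rsummable a).
  by rewrite -lee_fin rsum_ge0E// esum_ge0// => i _; rewrite lee_fin.
(* Without summability the first sum is infinite and [fine] returns its default value 0, which is
   still nonnegative. *)
rewrite /rsum.
rewrite [X in _ - fine X](_ : _ = 0%E); last first.
  apply: esum1 => i _; rewrite funenegE /= -EFin_max.
  by congr EFin; rewrite max_r// oppr_le0.
by rewrite subr0 fine_ge0// esum_ge0.
Qed.

Lemma le_rsum I (a b : I -> R) : rsummable a -> rsummable b ->
  (forall i, a i <= b i) -> rsum a <= rsum b.
Proof.
move=> sa sb ab; rewrite -subr_ge0 -rsumB//; apply: rsum_ge0 => i.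
by rewrite subr_ge0.
Qed.

Lemma ler_norm_rsum I (a b : I -> R) : rsummable b ->
  (forall i, `|a i| <= b i) -> `|rsum a| <= rsum b.
Proof.
move=> sb ab; have sa := rsummable_le ab sb.
rewrite ler_norml; apply/andP; split; last first.
  by apply: le_rsum => // i; rewrite (le_trans _ (ab i))// ler_norm.
rewrite lerNl -rsumN; apply: le_rsum => //; first exact: rsummableN.
by move=> i; rewrite (le_trans _ (ab i))// -normrN ler_norm.
Qed.

Lemma rsummable_finite I (a : I -> R) : finitely_supported a -> rsummable a.
Proof.
move=> fa; rewrite /rsummable /summable.
rewrite (_ : esum _ _ = \esum_(i in [set i | a i != 0]) `|(EFin \o a) i|%E).
  rewrite esum_fset// fsbig_finite//=.
  by rewrite sumEFin ltry.
rewrite [RHS]esum_mkcond; apply: eq_esum => i _.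
by case: ifPn => //; rewrite notin_setE /= => /negP; rewrite negbK => /eqP ->; rewrite normr0.
Qed.

Lemma rsum_delta I (a : I -> R) i : (forall j, j != i -> a j = 0) -> rsum a = a i.
Proof.
move=> a0.
suff E (b : I -> \bar R) : (forall j, j != i -> b j = 0%E) -> (0 <= b i)%E ->
    esum [set: I] b = b i.
  rewrite /rsum !E.
  - rewrite funeposE funenegE /= -!EFin_max/=.
    have [?|?] := leP 0 (a i); [rewrite max_r ?subr0//|rewrite max_l ?sub0r ?opprK//]; lra.
  - by move=> j ji; rewrite funenegE /= a0// oppr0 maxxx.
  - exact: funeneg_ge0.
  - by move=> j ji; rewrite funeposE /= a0// maxxx.
  - exact: funepos_ge0.
move=> b0 bi; rewrite -(@esum_set1 _ _ i b)// [RHS]esum_mkcond; apply: eq_esum => j _.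
by case: ifPn => //; rewrite notin_setE /= => /eqP; exact: b0.
Qed.

Lemma rsum_reindex I (h : I -> I) (a : I -> R) : bijective h ->
  rsum (fun i => a (h i)) = rsum a.
Proof.
rewrite -setTT_bijective => hb.
by rewrite /rsum; congr (fine _ - fine _); rewrite [RHS](reindex_esum _ _ _ _ hb);
  apply: eq_esum => i _;
  rewrite ?funeposE ?funenegE.
Qed.

Lemma rsummable_reindex I (h : I -> I) (a : I -> R) : bijective h ->
  rsummable a -> rsummable (fun i => a (h i)).
Proof.
rewrite -setTT_bijective => hb.
by rewrite /rsummable /summable [X in (X < _)%E -> _](reindex_esum _ _ _ _ hb).
Qed.

(** Every finite partial sum obeys the bound. One inequality is enough: [rsumZ] obtains equality by
    using it for [k] and for [k^-1]. *)
Lemma esumZ I (k : R) (a : I -> R) : 0 < k -> (forall i, 0 <= a i) ->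
  (\esum_(i in [set: I]) (k * a i)%:E <= k%:E * \esum_(i in [set: I]) (a i)%:E)%E.
Proof.
move=> k0 a0; apply: ge_ereal_sup => _ [A [finA _] <-].
under eq_fsbigr do rewrite EFinM.
rewrite -ge0_mule_fsumr; last by move=> i; rewrite lee_fin.
rewrite lee_pmul2l//; apply: esum_ge; exists A => //; split => //.
Qed.

Lemma rsummableZ I (k : R) (a : I -> R) : rsummable a ->
  rsummable (fun i => k * a i).
Proof.
move=> sa; have [->|k0] := eqVneq k 0.
  by apply: (rsummable_le _ (rsummable_norm sa)) => i; rewrite mul0r normr0.
rewrite /rsummable /summable /=.
under eq_esum do rewrite normrM.
apply: le_lt_trans (@esumZ _ _ (fun i => `|a i|) _ _) _ => //; first by rewrite normr_gt0.
by rewrite lte_mul_pinfty// ?lee_fin//; exact: ltW.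
Qed.

Lemma rsumZ I (k : R) (a : I -> R) : 0 < k -> (forall i, 0 <= a i) ->
  rsummable a -> rsum (fun i => k * a i) = k * rsum a.
Proof.
move=> k0 a0 sa.
have le l b : 0 < l -> (forall i, 0 <= b i) -> rsummable b ->
    rsum (fun i => l * b i) <= l * rsum b.
  move=> l0 b0 sb; rewrite -lee_fin EFinM !rsum_ge0E//; first exact: esumZ.
    by move=> i; rewrite mulr_ge0// ltW.
  exact: rsummableZ.
apply/eqP; rewrite eq_le le//= -ler_pdivlMl//.
rewrite -[X in X <= _](_ : rsum (fun i => k^-1 * (k * a i)) = _); last first.
  by apply: eq_rsum => i; rewrite mulKf// gt_eqF.
apply: le; rewrite ?invr_gt0//; last exact: rsummableZ.
by move=> i; rewrite mulr_ge0// ltW.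
Qed.

Lemma rsum_patch I (A : set I) (a : I -> R) : finite_set A ->
  (forall i, 0 <= a i) ->
  rsum (fun i => if i \in A then a i else 0) = \sum_(i \in A) a i.
Proof.
move=> finA a0.
have b0 i : 0 <= if i \in A then a i else 0 by case: ifP.
have sb : rsummable (fun i => if i \in A then a i else 0).
  apply: rsummable_finite; apply: sub_finite_set finA => i /=.
  by case: ifPn => [/set_mem//|_]; rewrite eqxx.
apply: EFin_inj; rewrite (rsum_ge0E b0 sb) -fsumEFin// -esum_fset//; last first.
  by move=> i _; rewrite lee_fin.
by rewrite [RHS]esum_mkcond; apply: eq_esum => i _; case: ifP.
Qed.

(** The maximum of finitely many thresholds serves all indices at once. *)
Lemma eventually_finite I (A : set I) (P : nat -> I -> Prop) : finite_set A ->
  (forall i, exists N, forall n, (N <= n)%N -> P n i) ->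
  exists N, forall n, (N <= n)%N -> forall i, A i -> P n i.
Proof.
move=> /finite_fsetP[B AB] /choice[N NP].
exists (\max_(i <- finmap.enum_fset B) N i)%N => n Nn i Ai; apply: NP.
by apply: leq_trans Nn; apply: leq_bigmax_seq => //; move: Ai; rewrite AB.
Qed.

(** Dominated convergence with eventual vanishing as pointwise hypothesis, which is what cutoffs
    provide. A finite set [A] carries the sum of [h] up to [eps], and [g n] vanishes on [A] for
    large [n]. *)
Lemma dominated_rsum I (g : nat -> I -> R) (h : I -> R) :
  rsummable h -> (forall n i, 0 <= g n i <= h i) ->
  (forall i, exists N, forall n, (N <= n)%N -> g n i = 0) ->
  forall eps, 0 < eps -> exists N, forall n, (N <= n)%N -> rsum (g n) < eps.
Proof.
move=> sh gh g0 eps eps0.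
have h0 i : 0 <= h i by have /andP[] := gh 0%N i; exact: le_trans.
have [A [finA _] hA] : exists2 A, fsets [set: I] A & rsum h - eps < \sum_(i \in A) h i.
  have : (rsum h - eps)%:E%E \is a fin_num by [].
  have : ((rsum h - eps)%:E < \esum_(i in [set: I]) (h i)%:E)%E.
    by rewrite -rsum_ge0E// lte_fin ltrBlDr ltrDl.
  move=> /ereal_sup_gt[_ [A [finA AT] <-] hA] _; exists A => //.
  by move: hA; rewrite fsumEFin// lte_fin.
have [N NP] := eventually_finite finA g0.
exists N => n /NP gA.
have sA : rsummable (fun i => if i \in A then h i else 0).
  by apply: (rsummable_le _ sh) => i; case: ifP; rewrite ?normr0// ger0_norm.
(* For such [n] the family [g n] lies below the tail of [h] outside [A]. *)
apply: le_lt_trans (_ : rsum (fun i => h i - if i \in A then h i else 0) < eps).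
  apply: le_rsum; last 1 first.
  - move=> i; case: ifPn => [/set_mem/gA ->|_]; first by rewrite subrr.
    by rewrite subr0; have /andP[] := gh n i.
  - by apply: (rsummable_le _ sh) => i; have /andP[? ?] := gh n i; rewrite ger0_norm.
  - by apply: rsummableD => //; exact: rsummableN.
by rewrite rsumB// rsum_patch// ltrBlDr addrC -ltrBlDr.
Qed.

(** * Summation along the finite fibers of a map *)

Section Fibers.
Variables (I J : choiceType) (h : J -> I).
Hypothesis finh : forall i, finite_set [set j | h j = i].

(** Fubini for nonnegative terms: [j] corresponds to the pair [(h j, j)] in the disjoint union of
    the fibers. It is used with [h] the target map from edges to vertices. *)
Lemma esum_fiber (a : J -> R) : (forall j, 0 <= a j) ->
  \esum_(i in [set: I]) (\sum_(j \in [set j | h j = i]) a j)%:E =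
  \esum_(j in [set: J]) (a j)%:E.
Proof.
move=> a0; transitivity (\esum_(i in [set: I]) \esum_(j in [set j | h j = i]) (a j)%:E).
  apply: eq_esum => i _; rewrite esum_fset// ?fsumEFin// => j _.
  by rewrite lee_fin.
rewrite esum_esum; last by move=> *; rewrite lee_fin.
rewrite (@reindex_esum _ _ _ [set: J] _ (fun j => (h j, j)))//; split=> //=.
- by move=> j1 j2 _ _ [].
- by move=> [i j] [/= _ <-]; exists j.
Qed.

Lemma fiber_sum_ge0 (a : J -> R) : (forall j, 0 <= a j) ->
  forall i, 0 <= \sum_(j \in [set j | h j = i]) a j.
Proof. by move=> a0 i; apply: fsumr_ge0. Qed.

Lemma rsummable_fiber_ge0 (a : J -> R) : (forall j, 0 <= a j) ->
  rsummable (fun i => \sum_(j \in [set j | h j = i]) a j) <-> rsummable a.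
Proof.
by move=> a0; rewrite (rsummable_ge0P (fiber_sum_ge0 a0)) (rsummable_ge0P a0) esum_fiber.
Qed.

Lemma rsum_fiber_ge0 (a : J -> R) : (forall j, 0 <= a j) -> rsummable a ->
  rsum (fun i => \sum_(j \in [set j | h j = i]) a j) = rsum a.
Proof.
move=> a0 sa; apply: EFin_inj.
by rewrite (rsum_ge0E (fiber_sum_ge0 a0))// ?esum_fiber ?rsum_ge0E//; exact/rsummable_fiber_ge0.
Qed.

Lemma rsummable_fiber (a : J -> R) : rsummable a ->
  rsummable (fun i => \sum_(j \in [set j | h j = i]) a j) /\
  rsum (fun i => \sum_(j \in [set j | h j = i]) a j) = rsum a.
Proof.
(* A difference of two nonnegative summable families again, which reduces the claim to the
   nonnegative case. *)
move=> sa; pose p j := `|a j| + a j; pose n j := `|a j|.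
have p0 j : 0 <= p j by rewrite /p; have := ler_norm (- a j); rewrite normrN; lra.
have n0 j : 0 <= n j by rewrite /n.
have sn : rsummable n by exact: rsummable_norm.
have sp : rsummable p by exact: rsummableD.
have -> : a = (fun j => p j - n j) by apply/funext => j; rewrite /p /n; lra.
rewrite (_ : (fun i => _) = fun i => \sum_(j \in [set j | h j = i]) p j -
    \sum_(j \in [set j | h j = i]) n j); last first.
  apply/funext => i; rewrite fsbig_split//=; congr (_ + _).
  by rewrite !fsbig_finite// sumrN.
have [sp' sn'] := (proj2 (rsummable_fiber_ge0 p0) sp, proj2 (rsummable_fiber_ge0 n0) sn).
split; first by apply: rsummableD => //; exact: rsummableN.
by rewrite !rsumB// !rsum_fiber_ge0.
Qed.

End Fibers.
End RealSums.

(** * Complex sums and weighted inner products *)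

Section ComplexSums.
Variable R : realType.
Implicit Type I : choiceType.
Local Open Scope complex_scope.

(** The squared modulus, kept as a real polynomial without square roots so that estimates reduce to
    real arithmetic. *)
Definition sqn (z : R[i]) : R := complex.Re z ^+ 2 + complex.Im z ^+ 2.

Lemma sqr_normc (z : R[i]) : Normc.normc z ^+ 2 = sqn z.
Proof. by case: z => a b; rewrite /= sqr_sqrtr// addr_ge0// sqr_ge0. Qed.

Lemma sqn_ge0 (z : R[i]) : 0 <= sqn z.
Proof. by rewrite addr_ge0// sqr_ge0. Qed.

Lemma sqnD (z t : R[i]) : sqn (z + t) <= 2 * (sqn z + sqn t).
Proof.
by case: z t => a b [x y]; rewrite /sqn /=; have := sqr_ge0 (a - x); have := sqr_ge0 (b - y); lra.
Qed.

Lemma sqnM (z t : R[i]) : sqn (z * t) = sqn z * sqn t.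
Proof. by case: z t => a b [x y]; rewrite /sqn /=; ring. Qed.

Lemma sqnN (z : R[i]) : sqn (- z) = sqn z.
Proof. by case: z => a b; rewrite /sqn /= !sqrrN. Qed.

Lemma sqnR (x : R) : sqn x%:C = x ^+ 2.
Proof. by rewrite /sqn /= expr0n addr0. Qed.

Lemma sqn0 : sqn 0 = 0.
Proof. by rewrite /sqn /= expr0n addr0. Qed.

Lemma conjE (z : R[i]) : (Num.conj z : R[i]) = conjc z.
Proof. by []. Qed.

Lemma conjR (x : R) : Num.conj (x%:C : R[i]) = x%:C.
Proof. by rewrite conjE conjc_real. Qed.

Lemma conjcM (z t : R[i]) : Num.conj (z * t) = Num.conj z * Num.conj t.
Proof. exact: rmorphM. Qed.

Lemma conjcN (z : R[i]) : Num.conj (- z) = - Num.conj z.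
Proof. exact: rmorphN. Qed.

Lemma real_complex_half : (2^-1)%:C = 2^-1 :> R[i].
Proof. by rewrite fmorphV rmorph_nat. Qed.

Lemma conjcD (z t : R[i]) : Num.conj (z + t) = Num.conj z + Num.conj t.
Proof. exact: rmorphD. Qed.

Lemma real_complex_mean (x y : R) : ((x + y) / 2)%:C = (x%:C + y%:C) / 2.
Proof. by rewrite -real_complex_half -rmorphD -rmorphM. Qed.

Lemma finitely_supported0 (I : Type) : finitely_supported (fun _ : I => 0 : R[i]).
Proof. by apply: sub_finite_set (finite_set0 _) => x /=; rewrite eqxx. Qed.

Lemma finitely_supported_lin (I : Type) (a : R[i]) (f g : I -> R[i]) :
  finitely_supported f -> finitely_supported g ->
  finitely_supported (fun x => a * f x + g x).
Proof.
move=> ff fg; apply: (@sub_finite_set _ _ ([set x | f x != 0] `|` [set x | g x != 0])).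
  move=> x /=; have [->|? _] := eqVneq (f x) 0; last by left.
  by rewrite mulr0 add0r; right.
by rewrite finite_setU.
Qed.

Lemma positive_realC (eps : R[i]) : 0 < eps -> exists2 e : R, 0 < e & eps = e%:C.
Proof.
by case: eps => a b; rewrite ltcE /= => /andP[/eqP -> a0]; exists a.
Qed.

(** Complex quantities are estimated through their real and imaginary parts, so that all bounds stay
    in [R]. *)
Lemma complex_triangle (z1 z2 z3 : R[i]) (m1 m2 m : R) :
  `|complex.Re (z1 - z3)| <= m1 -> `|complex.Im (z1 - z3)| <= m1 ->
  `|complex.Re (z2 - z3)| <= m2 -> `|complex.Im (z2 - z3)| <= m2 ->
  m1 + m2 <= m ->
  `|complex.Re (z1 - z2)| <= m /\ `|complex.Im (z1 - z2)| <= m.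
Proof.
case: z1 z2 z3 => [x1 y1] [x2 y2] [x3 y3] /=.
by rewrite !ler_norml => A1 A2 B1 B2 le; split; lra.
Qed.

Definition csummable I (z : I -> R[i]) :=
  rsummable (fun i => complex.Re (z i)) /\ rsummable (fun i => complex.Im (z i)).

Lemma csumB I (z t : I -> R[i]) : csummable z -> csummable t ->
  csum (fun i => z i - t i) = csum z - csum t.
Proof.
move=> [z1 z2] [t1 t2]; rewrite /csum -[RHS]/(_ +i* _) -rsumB// -rsumB//.
by congr (_ +i* _); apply: eq_rsum => i; case: (z i) (t i) => ? ? [].
Qed.

Lemma eq_csum I (z t : I -> R[i]) : z =1 t -> csum z = csum t.
Proof. by move=> /funext ->. Qed.

Lemma csumN I (z : I -> R[i]) : csum (fun i => - z i) = - csum z.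
Proof.
rewrite /csum -[RHS]/(_ +i* _) -!rsumN.
by congr (_ +i* _); apply: eq_rsum => i; case: (z i).
Qed.

Lemma csum_conj I (z : I -> R[i]) : csum (fun i => conjc (z i)) = conjc (csum z).
Proof.
rewrite /csum /= -rsumN.
by congr (_ +i* _); apply: eq_rsum => i; case: (z i).
Qed.

Lemma csum_delta I (z : I -> R[i]) i : (forall j, j != i -> z j = 0) -> csum z = z i.
Proof.
move=> z0; rewrite /csum (@rsum_delta _ _ _ i) ?(@rsum_delta _ _ _ i); first by case: (z i).
  by move=> j /z0 ->.
by move=> j /z0 ->.
Qed.

Lemma csummable_finite I (z : I -> R[i]) : finitely_supported z -> csummable z.
Proof.
by move=> fz; split; apply: rsummable_finite; apply: sub_finite_set fz => i /=;
  apply: contra_neq => ->.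
Qed.

Lemma csum_reindex I (h : I -> I) (z : I -> R[i]) : bijective h ->
  csum (fun i => z (h i)) = csum z.
Proof.
move=> hb; rewrite /csum; congr (_ +i* _).
  exact: (@rsum_reindex _ _ _ (fun i => complex.Re (z i))).
exact: (@rsum_reindex _ _ _ (fun i => complex.Im (z i))).
Qed.

Lemma csum_fiber I (J : choiceType) (h : J -> I) (z : J -> R[i]) :
  (forall i, finite_set [set j | h j = i]%classic) -> csummable z ->
  csum (fun i => \sum_(j \in [set j | h j = i]%classic) z j) = csum z.
Proof.
move=> fh [z1 z2]; rewrite /csum -(rsummable_fiber fh z1).2 -(rsummable_fiber fh z2).2.
congr (_ +i* _); apply: eq_rsum => i; rewrite !fsbig_finite//.
  exact: (raddf_sum (@complex.Re R : Rcomplex R -> R)).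
exact: (raddf_sum (@complex.Im R : Rcomplex R -> R)).
Qed.

(** * Weighted square-summable functions, for vertices and edges alike *)

Section WeightedProduct.
Variables (I : choiceType) (w : I -> R).
Hypothesis w_gt0 : forall i, 0 < w i.
Implicit Types f g : I -> R[i]^o.

Definition wl2 f := rsummable (fun i => w i * sqn (f i)).

Definition wnorm2 f := rsum (fun i => w i * sqn (f i)).

Definition wprod f g : R[i] := csum (fun i => (w i)%:C * f i * (g i)^*)%R.

Lemma wsqn_ge0 f i : 0 <= w i * sqn (f i).
Proof. by rewrite mulr_ge0 ?sqn_ge0// ltW. Qed.

Lemma wprod_self f : wprod f f = (wnorm2 f)%:C.
Proof.
rewrite /wprod /csum; congr (_ +i* _).
  by apply: eq_rsum => i; rewrite conjE /sqn; case: (f i) => a b /=; ring.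
rewrite -[RHS](@rsum0 R I); apply: eq_rsum => i.
by rewrite conjE; case: (f i) => a b /=; ring.
Qed.

Lemma wnorm2_ge0 f : 0 <= wnorm2 f.
Proof. exact: rsum_ge0 (wsqn_ge0 f). Qed.

Lemma wprod_conj f g : wprod g f = conjc (wprod f g).
Proof.
rewrite -csum_conj; apply: eq_csum => i; rewrite !conjE.
by case: (f i) (g i) => a b [x y]; rewrite /=; congr (_ +i* _); ring.
Qed.

Lemma wl2_finite f : finitely_supported f -> wl2 f.
Proof.
move=> ff; apply: rsummable_finite; apply: sub_finite_set ff => i /=.
by apply: contra_neq => ->; rewrite sqn0 mulr0.
Qed.

Lemma wl2D f g : wl2 f -> wl2 g -> wl2 (f \+ g).
Proof.
move=> lf lg.
apply: (rsummable_le _ (rsummableZ 2 (rsummableD lf lg))) => i.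
rewrite ger0_norm ?wsqn_ge0// -mulrDr mulrCA ler_pM2l//; exact: sqnD.
Qed.

Lemma wl2N f : wl2 f -> wl2 (\- f).
Proof. by move=> lf; apply: (rsummable_le _ lf) => i; rewrite ger0_norm ?wsqn_ge0//= sqnN. Qed.

Lemma wl2B f g : wl2 f -> wl2 g -> wl2 (f \- g).
Proof. by move=> lf lg; apply: wl2D => //; exact: wl2N. Qed.

(* AM-GM with a free parameter [t] replaces the Cauchy-Schwarz inequality. *)
Lemma wprod_term_bound (t : R) f g i : 0 < t ->
  let z := ((w i)%:C * f i * (g i)^* )%R in
  let m := 2^-1 * (t * (w i * sqn (f i)) + t^-1 * (w i * sqn (g i))) in
  `|complex.Re z| <= m /\ `|complex.Im z| <= m.
Proof.
move=> t0 z m.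
have mE : m = w i * ((t * sqn (f i) + t^-1 * sqn (g i)) / 2) by rewrite /m; ring.
have am (x y : R) : x * y <= (t * x ^+ 2 + t^-1 * y ^+ 2) / 2.
  have : 0 <= t^-1 * (t * x - y) ^+ 2 by rewrite mulr_ge0 ?sqr_ge0// invr_ge0 ltW.
  rewrite (_ : t^-1 * (t * x - y) ^+ 2 = t * x ^+ 2 + t^-1 * y ^+ 2 - 2 * (x * y)); first lra.
  by field; rewrite gt_eqF.
rewrite mE /z conjE /sqn; case: (f i) (g i) => a b [x y] /=.
(* The real part is [w i * (a * x + b * y)] and the imaginary part [w i * (b * x - a * y)]; both
   signs of each product are bounded, since absolute values are wanted. *)
have [H1 H2 H3 H4] := And4 (am a x) (am b y) (am (- a) x) (am (- b) y).
have [H5 H6 H7 H8] := And4 (am b x) (am a y) (am (- b) x) (am (- a) y).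
rewrite !sqrrN !mulNr in H3 H4 H7 H8.
rewrite !mul0r !subr0 !addr0.
rewrite (_ : _ - _ = w i * (a * x + b * y)); last by ring.
rewrite (_ : _ + w i * b * x = w i * (b * x - a * y)); last by ring.
by rewrite !normrM (gtr0_norm (w_gt0 i)) !ler_pM2l// !ler_norml; split; lra.
Qed.

(** The termwise bounds are summed. The parameter [t] stays free, so that [eq0_of_bound] can make
    the first norm small against the second. *)
Lemma wprod_bound (t : R) f g : 0 < t -> wl2 f -> wl2 g ->
  let m := 2^-1 * (t * wnorm2 f + t^-1 * wnorm2 g) in
  `|complex.Re (wprod f g)| <= m /\ `|complex.Im (wprod f g)| <= m.
Proof.
move=> t0 lf lg m.
have t'0 : 0 < t^-1 by rewrite invr_gt0.
have sm : rsummable (fun i => 2^-1 * (t * (w i * sqn (f i)) + t^-1 * (w i * sqn (g i)))).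
  by apply: rsummableZ; apply: rsummableD; exact: rsummableZ.
have -> : m = rsum (fun i => 2^-1 * (t * (w i * sqn (f i)) + t^-1 * (w i * sqn (g i)))).
  have ge0 (s : R) h : 0 < s -> forall i, 0 <= s * (w i * sqn (h i)).
    by move=> s0 i; rewrite mulr_ge0 ?wsqn_ge0// ltW.
  rewrite rsumZ//.
  - rewrite rsumD ?rsumZ//; first exact: wsqn_ge0.
    + exact: wsqn_ge0.
    + exact: rsummableZ.
    + exact: rsummableZ.
  - by move=> i; rewrite addr_ge0// ge0.
  - by apply: rsummableD; exact: rsummableZ.
by split; apply: ler_norm_rsum => // i; have [] := wprod_term_bound f g i t0.
Qed.

Lemma csummable_wprod f g : wl2 f -> wl2 g ->
  csummable (fun i => (w i)%:C * f i * (g i)^* )%R.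
Proof.
move=> lf lg.
have sm : rsummable (fun i => 2^-1 * (1 * (w i * sqn (f i)) + 1^-1 * (w i * sqn (g i)))).
  by apply: rsummableZ; apply: rsummableD; exact: rsummableZ.
by split; apply: (rsummable_le _ sm) => i; have [] := wprod_term_bound f g i ltr01.
Qed.

Lemma wprodBl f f' g : wl2 f -> wl2 f' -> wl2 g ->
  wprod (f \- f') g = wprod f g - wprod f' g.
Proof.
move=> lf lf' lg; rewrite -csumB; [|exact: csummable_wprod..].
by apply: eq_csum => i; rewrite /= mulrBr mulrBl.
Qed.

End WeightedProduct.
End ComplexSums.

(** * Dominated convergence for weighted norms *)

Section Vanishing.
Variable R : realType.
Implicit Types a b : nat -> R.

(* For nonnegative sequences this is convergence to [0]. *)
Definition vanishing a := forall eps : R, 0 < eps ->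
  exists N, forall n, (N <= n)%N -> a n < eps.

Lemma vanishingD a b : vanishing a -> vanishing b -> vanishing (fun n => a n + b n).
Proof.
move=> va vb eps e0; have e20 : 0 < eps / 2 by rewrite divr_gt0.
have [[N1 P1] [N2 P2]] := (va _ e20, vb _ e20).
exists (maxn N1 N2) => n; rewrite geq_max => /andP[n1 n2].
by have := P1 _ n1; have := P2 _ n2; lra.
Qed.

Lemma vanishing_le (k : R) a b : 0 < k -> (forall n, b n <= k * a n) ->
  vanishing a -> vanishing b.
Proof.
move=> k0 ba va eps e0; have [N NP] := va (eps / k) (divr_gt0 e0 k0).
exists N => n /NP; rewrite ltr_pdivlMr// mulrC; exact: le_lt_trans.
Qed.

(** The usual quadratic argument, with a positive upper bound [L] in place of the sum of
    [w j * x j ^+ 2], so that division never meets zero. For the graph, [L] will be [c x * M]. *)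
Lemma weighted_cauchy_schwarz (J : Type) (s : seq J) (w x y : J -> R) (L : R) :
  (forall j, 0 < w j) -> 0 < L -> \sum_(j <- s) w j * x j ^+ 2 <= L ->
  (\sum_(j <- s) w j * x j * y j) ^+ 2 <= L * \sum_(j <- s) w j * y j ^+ 2.
Proof.
move=> w0 L0 xL; set S := \sum_(j <- s) _ * _ * _.
have : 0 <= \sum_(j <- s) w j * (L * y j - S * x j) ^+ 2.
  by apply: sumr_ge0 => j _; rewrite mulr_ge0 ?sqr_ge0// ltW.
(* Expanding gives L^2 B - 2 L S^2 + S^2 A, with A <= L. *)
rewrite (eq_bigr (fun j => L ^+ 2 * (w j * y j ^+ 2) + (- (2 * L * S)) * (w j * x j * y j) +
  S ^+ 2 * (w j * x j ^+ 2))); last by move=> j _; ring.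
rewrite !big_split /= -!mulr_sumr -/S => pos.
have := ler_wpM2l (sqr_ge0 S) xL.
move: pos; move: (\sum_(j <- s) _) (\sum_(j <- s) _) => B A pos le.
by rewrite -(ler_pM2l L0); move: pos le; rewrite !expr2; lra.
Qed.

(* Take t = (S + 1) / |q| and eps = |q| / t. *)
Lemma eq0_of_bound (q S : R) : 0 <= S ->
  (forall t eps : R, 0 < t -> 0 < eps -> `|q| <= 2^-1 * (t * eps + t^-1 * S)) -> q = 0.
Proof.
move=> S0 bnd; apply/eqP; apply: contraT; rewrite -normr_gt0 => q0.
have t0 : 0 < (S + 1) / `|q| by rewrite divr_gt0// ltr_wpDl.
have e0 : 0 < `|q| / ((S + 1) / `|q|) by rewrite divr_gt0.
have := bnd _ _ t0 e0; rewrite [X in _ <= _ * (X + _)]mulrC divfK ?gt_eqF// invf_div.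
have : `|q| / (S + 1) * S < `|q|.
  by rewrite mulrAC ltr_pdivrMr ?ltr_wpDl// ltr_pM2l// ltrDl.
lra.
Qed.

End Vanishing.

Section WeightedVanishing.
Variables (R : realType) (I : choiceType) (w : I -> R).
Hypothesis w_gt0 : forall i, 0 < w i.
Local Open Scope complex_scope.

Lemma dominated_wnorm2 (g : nat -> I -> R[i]^o) (h : I -> R) : rsummable h ->
  (forall n i, w i * sqn (g n i) <= h i) ->
  (forall i, exists N, forall n, (N <= n)%N -> g n i = 0) ->
  vanishing (fun n => wnorm2 w (g n)).
Proof.
move=> sh gh g0; apply: (dominated_rsum sh) => [n i|i].
  by rewrite gh wsqn_ge0.
by have [N NP] := g0 i; exists N => n /NP ->; rewrite sqn0 mulr0.
Qed.

Lemma wsqn_cutoff (m : R) (z : R[i]) i : 0 <= m <= 1 ->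
  w i * sqn (m%:C * z) <= w i * sqn z.
Proof.
move=> /andP[m_ge0 m_le1].
by rewrite ler_pM2l// sqnM sqnR ler_piMl ?sqn_ge0// expr_le1.
Qed.

Lemma wl2_cutoff (m : I -> R) (f : I -> R[i]^o) : wl2 w f ->
  (forall i, 0 <= m i <= 1) -> wl2 w (fun i => (m i)%:C * f i).
Proof.
move=> lf m01; apply: (rsummable_le _ lf) => i.
by rewrite ger0_norm; [exact: wsqn_cutoff (m01 i)|by rewrite mulr_ge0 ?sqn_ge0 ?ltW].
Qed.

Lemma vanishing_cutoff (m : nat -> I -> R) (f : I -> R[i]^o) : wl2 w f ->
  (forall n i, 0 <= m n i <= 1) ->
  (forall i, exists N, forall n, (N <= n)%N -> m n i = 0) ->
  vanishing (fun n => wnorm2 w (fun i => (m n i)%:C * f i)).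
Proof.
move=> lf m01 m0; apply: (dominated_wnorm2 lf) => [n i|i]; last first.
  by have [N NP] := m0 i; exists N => n /NP ->; rewrite mul0r.
exact: wsqn_cutoff.
Qed.

Lemma wnorm2D_le (f g : I -> R[i]^o) : wl2 w f -> wl2 w g ->
  wnorm2 w (f \+ g) <= 2 * (wnorm2 w f + wnorm2 w g).
Proof.
move=> lf lg; rewrite /wnorm2 -rsumD// -rsumZ//; last 2 first.
- by move=> i; rewrite addr_ge0// wsqn_ge0.
- exact: rsummableD.
apply: le_rsum => [||i]; first exact: wl2D.
  by apply: rsummableZ; exact: rsummableD.
by rewrite -mulrDr mulrCA ler_pM2l//; exact: sqnD.
Qed.

End WeightedVanishing.

(** * The Gauss-Bonnet operator *)

Section GaussBonnet.
Variables (R : realType) (K : graph) (c : K -> R) (r : edge K -> R).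
Hypothesis hfin : locally_finite K.
Hypothesis c_gt0 : forall v : K, 0 < c v.
Hypothesis r_gt0 : forall e : edge K, 0 < r e.
Hypothesis r_sym : forall e : edge K, r (opp_edge e) = r e.
Local Open Scope classical_set_scope.
Local Open Scope complex_scope.

Local Notation H := (hilbert_sum c r).
Local Notation ip := (ip_sum c r).
Local Notation dom := (@gauss_bonnet_domain R K).
Local Notation D := (gauss_bonnet c r).
Local Notation antisym := (@antisymmetric1 R K).
Implicit Types (p q u : Cochains R K).

(** * Edge reversal and Green's formula *)

Lemma opp_edgeK : involutive (@opp_edge K).
Proof. by move=> e; apply: val_inj; case: e => -[x y]. Qed.

Lemma opp_edge_bij : bijective (@opp_edge K).
Proof. exact: inv_bij opp_edgeK. Qed.

Lemma finite_tgt (x : K) : finite_set [set e : edge K | tgt e = x].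
Proof. by apply: sub_finite_set (hfin x) => e; left. Qed.

Lemma finite_src (x : K) : finite_set [set e : edge K | src e = x].
Proof. by apply: sub_finite_set (hfin x) => e; right. Qed.

Lemma differential_antisym (f : Cochain0 R K) : antisym (differential f).
Proof. by move=> e; rewrite /differential opprB. Qed.

(** Both sides equal the sum over oriented edges of [z]. The support condition bears on a product,
    so that it covers finite support of [phi] and, by local finiteness, of [f]. *)
Lemma green (f : Cochain0 R K) (phi : Cochain1 R K) : antisym phi ->
  finitely_supported (fun e => f (tgt e) * phi e : R[i]) ->
  ip0 c f (codifferential c r phi) = ip1 r (differential f) phi.
Proof.
move=> aphi fs; pose z e : R[i] := ((r e)%:C * (f (tgt e) * (phi e)^* ))%R.
have sz : csummable z.
  apply: csummable_finite; apply: sub_finite_set fs => e /=; apply: contra_neq.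
  by move=> /eqP; rewrite mulf_eq0 => /orP[|] /eqP E; rewrite /z E ?mul0r ?rmorph0 ?mulr0.
have szo : csummable (fun e => - z (opp_edge e)).
  have [s1 s2] := sz; split.
    rewrite (_ : (fun i => _) = fun i => - complex.Re (z (opp_edge i))).
      apply: rsummableN; exact: (rsummable_reindex opp_edge_bij s1).
    by apply/funext => i; case: (z _).
  rewrite (_ : (fun i => _) = fun i => - complex.Im (z (opp_edge i))).
    apply: rsummableN; exact: (rsummable_reindex opp_edge_bij s2).
  by apply/funext => i; case: (z _).
(* Vertex side: the edges are grouped by target, and the weight [c x] cancels against the
   normalization of the codifferential. *)
transitivity (csum z).
  rewrite -(csum_fiber finite_tgt sz); apply: eq_csum => x.
  rewrite /codifferential conjcM conjR mulrACA -rmorphM mulfV ?gt_eqF// mul1r.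
  rewrite !fsbig_finite; [|exact: finite_tgt..].
  rewrite rmorph_sum mulr_sumr; apply: eq_big_seq => e.
  rewrite in_fset_set; last exact: finite_tgt.
  by rewrite inE /= => <-; rewrite /z conjcM conjR mulrCA.
(* Edge side: by antisymmetry the source term at [e] is the target term at the reversed edge. The
   two sums agree, which absorbs the factor one half. *)
rewrite /ip1 [X in _ = _ * X](eq_csum (t := fun e => z e - - z (opp_edge e))); last first.
  move=> e; rewrite /z r_sym aphi /differential conjcN /tgt /src /=; ring.
rewrite csumB// csumN csum_reindex; last exact: opp_edge_bij.
by field.
Qed.

(** * The direct sum space, its norm and its inner product *)

Lemma hilbert_sumE p : H p <-> [/\ wl2 c p.1, antisym p.2 & wl2 r p.2].
Proof.
have E0 : L2V c p.1 <-> wl2 c p.1.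
  rewrite /wl2 (rsummable_ge0P (wsqn_ge0 c_gt0 _)) /L2V /=.
  by under eq_esum do rewrite sqr_normc.
have E1 : (\esum_(e in [set: edge K]) (2^-1 * (r e * Normc.normc (p.2 e) ^+ 2))%:E < +oo)%E
    <-> wl2 r p.2.
  have h0 e : 0 <= 2^-1 * (r e * sqn (p.2 e)) by rewrite mulr_ge0 ?invr_ge0// wsqn_ge0.
  under eq_esum do rewrite sqr_normc.
  rewrite -(rsummable_ge0P h0); split; last exact: rsummableZ.
  move=> /(rsummableZ 2); congr rsummable; apply/funext => e.
  by rewrite mulVKf// pnatr_eq0.
split=> [[/E0 ? [? /E1 ?]] //|[/E0 ? ? /E1 ?]]; by split.
Qed.

Definition norm2 p := wnorm2 c p.1 + 2^-1 * wnorm2 r p.2.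

Lemma norm2_ge0 p : 0 <= norm2 p.
Proof. by rewrite addr_ge0 ?mulr_ge0 ?invr_ge0 ?wnorm2_ge0. Qed.

Lemma ip_self p : ip p p = (norm2 p)%:C.
Proof.
rewrite -[LHS]/(wprod c p.1 p.1 + 2^-1 * wprod r p.2 p.2) !wprod_self.
by rewrite -real_complex_half -[X in _ + X]rmorphM -rmorphD.
Qed.

Lemma ip_conj p q : ip q p = conjc (ip p q).
Proof.
rewrite -conjE /ip_sum conjcD /ip1 conjcM -real_complex_half conjR.
by congr (_ + _ * _); [exact: (wprod_conj c p.1 q.1)|exact: (wprod_conj r p.2 q.2)].
Qed.

Lemma ipBl p p' q : H p -> H p' -> H q -> ip (p - p') q = ip p q - ip p' q.
Proof.
move=> /hilbert_sumE[f1 _ f2] /hilbert_sumE[g1 _ g2] /hilbert_sumE[h1 _ h2].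
have E0 : ip0 c (p - p').1 q.1 = ip0 c p.1 q.1 - ip0 c p'.1 q.1 by exact: wprodBl.
have E1 : ip1 r (p - p').2 q.2 = ip1 r p.2 q.2 - ip1 r p'.2 q.2.
  by rewrite /ip1 -mulrBr; congr (_ * _); exact: wprodBl.
rewrite /ip_sum E0 E1; ring.
Qed.

Lemma hilbert_sumB p p' : H p -> H p' -> H (p - p').
Proof.
move=> /hilbert_sumE[f1 a1 f2] /hilbert_sumE[g1 a2 g2]; apply/hilbert_sumE; split.
- exact: wl2B.
- move=> e; rewrite -[LHS]/(p.2 (opp_edge e) - p'.2 (opp_edge e)) a1 a2.
  by rewrite -[RHS]/(- (p.2 e - p'.2 e)) opprB opprK addrC.
- exact: wl2B.
Qed.

Lemma ip_bound (t : R) p q : 0 < t -> H p -> H q ->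
  let m := 2^-1 * (t * norm2 p + t^-1 * norm2 q) in
  `|complex.Re (ip p q)| <= m /\ `|complex.Im (ip p q)| <= m.
Proof.
move=> t0 /hilbert_sumE[f1 _ f2] /hilbert_sumE[h1 _ h2] m.
have [A1 A2] := wprod_bound c_gt0 t0 f1 h1.
have [B1 B2] := wprod_bound r_gt0 t0 f2 h2.
have -> : ip p q = wprod c p.1 q.1 + (2^-1)%:C * wprod r p.2 q.2.
  by rewrite real_complex_half.
move: A1 A2 B1 B2; rewrite /m /norm2.
case: (wprod c p.1 q.1) (wprod r p.2 q.2) => a b [x y] /=.
rewrite !mul0r addr0 subr0 !ler_norml => A1 A2 B1 B2.
have -> : 2^-1 * (t * (wnorm2 c p.1 + 2^-1 * wnorm2 r p.2) +
    t^-1 * (wnorm2 c q.1 + 2^-1 * wnorm2 r q.2)) =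
  2^-1 * (t * wnorm2 c p.1 + t^-1 * wnorm2 c q.1) +
  2^-1 * (2^-1 * (t * wnorm2 r p.2 + t^-1 * wnorm2 r q.2)) by ring.
by split; lra.
Qed.

(** * Finite supports, linearity and symmetry of the operator *)

Lemma finite_tgt_preimage (A : set K) : finite_set A ->
  finite_set [set e : edge K | A (tgt e)].
Proof.
move=> fA; rewrite (_ : [set e | _] = \bigcup_(x in A) [set e : edge K | tgt e = x]).
  by apply: bigcup_finite => // x _; exact: finite_tgt.
by apply/seteqP; split=> [e Ae|e [x Ax /= ->]//]; exists (tgt e).
Qed.

Lemma finite_src_preimage (A : set K) : finite_set A ->
  finite_set [set e : edge K | A (src e)].
Proof.
move=> fA; rewrite (_ : [set e | _] = \bigcup_(x in A) [set e : edge K | src e = x]).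
  by apply: bigcup_finite => // x _; exact: finite_src.
by apply/seteqP; split=> [e Ae|e [x Ax /= ->]//]; exists (src e).
Qed.

Lemma differential_finite (f : Cochain0 R K) :
  finitely_supported f -> finitely_supported (differential f).
Proof.
move=> ff; apply: (@sub_finite_set _ _ ([set e | f (tgt e) != 0] `|` [set e | f (src e) != 0])).
  move=> e /=; rewrite /differential; have [->|? _] := eqVneq (f (tgt e)) 0; last by left.
  by rewrite sub0r oppr_eq0; right.
rewrite finite_setU; split.
  exact: (@finite_tgt_preimage [set x | f x != 0]).
exact: (@finite_src_preimage [set x | f x != 0]).
Qed.

Lemma codifferential_finite (phi : Cochain1 R K) :
  finitely_supported phi -> finitely_supported (codifferential c r phi).
Proof.
move=> fphi; apply: sub_finite_set (finite_image (@tgt K) fphi) => x /=.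
apply: contra_neqP => nx; rewrite /codifferential fsbig1 ?mulr0// => e /= ex.
have [->|pe] := eqVneq (phi e) 0; first by rewrite mulr0.
by exfalso; apply: nx; exists e.
Qed.

Lemma dom_hilbert : dom `<=` H.
Proof.
by move=> u [u1 u2 u3]; apply/hilbert_sumE; split => //; exact: wl2_finite.
Qed.

Lemma gauss_bonnet_dom u : dom u -> dom (D u).
Proof.
move=> [u1 u2 u3]; split; [exact: codifferential_finite|exact: differential_finite|].
exact: differential_antisym.
Qed.

(** Green's formula applies once with [u.1] and once, up to conjugation, with [u.2] as the finitely
    supported factor. As [p] ranges over all antisymmetric pairs, this yields both symmetry on the
    domain and the formal adjoint relation for arbitrary [p]. *)
Lemma gauss_bonnet_green u p : dom u -> antisym p.2 -> ip (D u) p = ip u (D p).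
Proof.
move=> [u1 u2 u3] ap; rewrite /ip_sum /=.
have -> : ip0 c u.1 (codifferential c r p.2) = ip1 r (differential u.1) p.2.
  apply: green => //; apply: sub_finite_set (finite_tgt_preimage u1) => e /=.
  by apply: contra_neq => ->; rewrite mul0r.
have E : ip0 c p.1 (codifferential c r u.2) = ip1 r (differential p.1) u.2.
  apply: green => //; apply: sub_finite_set u2 => e /=.
  by apply: contra_neq => ->; rewrite mulr0.
rewrite addrC; congr (_ + _).
have -> : ip0 c (codifferential c r u.2) p.1 = conjc (ip0 c p.1 (codifferential c r u.2)).
  exact: wprod_conj.
rewrite E /ip1 -conjE conjcM -real_complex_half conjR; congr (_ * _).
by rewrite conjE -csum_conj; apply: eq_csum => e; rewrite -conjE !conjcM conjR conjCK mulrAC.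
Qed.

Lemma gauss_bonnet_linear : linear_operator H dom D.
Proof.
split; first exact: dom_hilbert.
- by split=> [||e]; rewrite ?oppr0//; exact: finitely_supported0.
- by move=> u /gauss_bonnet_dom/dom_hilbert.
move=> a u v [u1 u2 u3] [v1 v2 v3]; split; first split.
- exact: finitely_supported_lin.
- exact: finitely_supported_lin.
- move=> e; rewrite -[LHS]/(a * u.2 (opp_edge e) + v.2 (opp_edge e)) u3 v3.
  by rewrite -[RHS]/(- (a * u.2 e + v.2 e)) mulrN opprD.
congr (_, _).
  apply/funext => x.
  rewrite -[RHS]/(a * codifferential c r u.2 x + codifferential c r v.2 x) /codifferential.
  rewrite mulrCA -mulrDr; congr (_ * _).
  rewrite !fsbig_finite; [|exact: finite_tgt..].
  rewrite mulr_sumr -big_split; apply: eq_bigr => e _ /=.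
  by rewrite mulrCA -mulrDr.
apply/funext => e.
rewrite -[RHS]/(a * (u.1 (tgt e) - u.1 (src e)) + (v.1 (tgt e) - v.1 (src e))).
rewrite -[LHS]/((a * u.1 (tgt e) + v.1 (tgt e)) - (a * u.1 (src e) + v.1 (src e))).
ring.
Qed.

(** * Test elements and passage to the graph closure *)

Lemma opp_edge_neq (e : edge K) : opp_edge e != e.
Proof.
apply/eqP => /(congr1 val) /= E.
have := adj_irr (src e); rewrite {2}/src -[X in X.1]E /=.
by have := valP e; rewrite /src /tgt /= => ->.
Qed.

(** Pairing with the indicator of a vertex [x] gives [c x] times the value at [x]. Pairing with the
    cochain that is 1 on [e] and -1 on its reverse gives [r e] times the value at [e], since the two
    orientations contribute equally. *)
Lemma antisym_eq p q : antisym p.2 -> antisym q.2 ->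
  (forall u, dom u -> ip p u = ip q u) -> p = q.
Proof.
move=> ap aq pq.
have finite1 (I : choiceType) (f : I -> R[i]^o) (i j : I) :
    (forall k, k != i -> k != j -> f k = 0) -> finitely_supported f.
  move=> f0; apply: (@sub_finite_set _ _ ([set i] `|` [set j])) => [k /=|].
    have [->|ki] := eqVneq k i; first by left.
    have [->|kj] := eqVneq k j; first by right.
    by rewrite f0// eqxx.
  by rewrite finite_setU.
have z0 (f : Cochain0 R K) : ip0 c f 0 = 0.
  rewrite /ip0 (eq_csum (t := fun=> (0 : R[i]))) => [|i]; last by rewrite rmorph0 mulr0.
  by rewrite /csum !rsum0.
have z1 (f : Cochain1 R K) : ip1 r f 0 = 0.
  rewrite /ip1 (eq_csum (t := fun=> (0 : R[i]))) => [|i]; last by rewrite rmorph0 mulr0.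
  by rewrite /csum !rsum0 mulr0.
have Cneq0 (x : R) : 0 < x -> x%:C != 0 :> R[i] by move=> x0; rewrite fmorph_eq0 gt_eqF.
rewrite [p]surjective_pairing [q]surjective_pairing; congr (_, _); apply/funext.
  move=> x; pose d : Cochain0 R K := fun y => if y == x then 1 else 0.
  have dd : dom (d, 0).
    split=> [||e]; [|exact: finitely_supported0|by rewrite oppr0].
    by apply: (finite1 _ d x x) => k /negbTE kx _; rewrite /d kx.
  have E (f : Cochain0 R K) : ip0 c f d = (c x)%:C * f x.
    rewrite /ip0 (csum_delta (i := x)) /d ?eqxx ?rmorph1 ?mulr1// => y /negbTE ->.
    by rewrite rmorph0 mulr0.
  by have := pq _ dd; rewrite /ip_sum /= !z1 !addr0 !E; apply/mulfI/Cneq0.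
move=> e; pose d : Cochain1 R K :=
  fun k => if k == e then 1 else if k == opp_edge e then - 1 else 0.
have ad : antisym d.
  move=> k; rewrite /d (inv_eq opp_edgeK) (inj_eq (inv_inj opp_edgeK)).
  (* The absence of loops keeps the values prescribed on [e] and on its reverse from clashing. *)
  have [->|ke] := eqVneq k e; first by rewrite eq_sym (negbTE (opp_edge_neq e)).
  by case: ifP; rewrite ?opprK ?oppr0.
have dd : dom (0, d).
  split=> //; first exact: finitely_supported0.
  by apply: (finite1 _ d e (opp_edge e)) => k /negbTE ke /negbTE ko; rewrite /d ke ko.
have E (f : Cochain1 R K) : antisym f -> ip1 r f d = (r e)%:C * f e.
  move=> af; pose z k : R[i] := if k == e then (r e)%:C * f e else 0.
  have sz : finitely_supported z.
    by apply: (finite1 _ z e e) => k /negbTE ke _; rewrite /z ke.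
  have szo : finitely_supported (fun k => - z (opp_edge k)).
    apply: (finite1 _ _ (opp_edge e) (opp_edge e)) => k /negbTE ke _.
    by rewrite /z (inv_eq opp_edgeK) ke oppr0.
  rewrite /ip1 (eq_csum (t := fun k => z k - - z (opp_edge k))).
    rewrite csumB; [|exact: csummable_finite..].
    rewrite csumN csum_reindex; last exact: opp_edge_bij.
    rewrite (csum_delta (i := e)) /z ?eqxx => [|j /negbTE -> //].
    by field.
  move=> k; rewrite /z /d (inv_eq opp_edgeK).
  have [->|ke] := eqVneq k e.
    by rewrite eq_sym (negbTE (opp_edge_neq e)) rmorph1 oppr0 subr0 mulr1.
  have [->|ko] := eqVneq k (opp_edge e); last by rewrite rmorph0 mulr0 oppr0 subr0.
  by rewrite r_sym af conjcN rmorph1; ring.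
by have := pq _ dd; rewrite /ip_sum /= !z0 !add0r !E//; apply/mulfI/Cneq0.
Qed.

(** A duality relation known on the domain passes to limits in the graph norm. It is used for the
    inclusion of the closure in [max_graph] and for that of [max_graph] in the adjoint. *)
Lemma graph_closure_dual G a b : graph_closure H ip (op_graph dom D) G -> H a -> H b ->
  (forall u, dom u -> ip (D u) b = ip u a) -> ip G.2 b = ip G.1 a.
Proof.
move=> [H1 H2 cl] Ha Hb dual.
have S0 : 0 <= norm2 a + norm2 b by rewrite addr_ge0 ?norm2_ge0.
have key (t eps : R) : 0 < t -> 0 < eps ->
    `|complex.Re (ip G.2 b - ip G.1 a)| <= 2^-1 * (t * eps + t^-1 * (norm2 a + norm2 b)) /\
    `|complex.Im (ip G.2 b - ip G.1 a)| <= 2^-1 * (t * eps + t^-1 * (norm2 a + norm2 b)).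
  move=> t0 e0; have ec0 : (0 : R[i]) < eps%:C by rewrite ltcR.
  have [_ [u du <-] /=] := cl _ ec0.
  rewrite !ip_self -rmorphD ltcR => near.
  have Hu := dom_hilbert du; have HDu := dom_hilbert (gauss_bonnet_dom du).
  have [A1 A2] := ip_bound t0 (hilbert_sumB H2 HDu) Hb.
  have [B1 B2] := ip_bound t0 (hilbert_sumB H1 Hu) Ha.
  rewrite !ipBl// in A1 A2 B1 B2; rewrite dual// in A1 A2.
  have le : 2^-1 * (t * norm2 (G.2 - D u) + t^-1 * norm2 b) +
      2^-1 * (t * norm2 (G.1 - u) + t^-1 * norm2 a) <=
      2^-1 * (t * eps + t^-1 * (norm2 a + norm2 b)).
    rewrite -mulrDr ler_pM2l ?invr_gt0//.
    have : t * (norm2 (G.1 - u) + norm2 (G.2 - D u)) <= t * eps by rewrite ler_pM2l// ltW.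
    rewrite !mulrDr; lra.
  (* The intermediate point is the common value of [ip (D u) b] and [ip u a]. *)
  exact: complex_triangle A1 A2 B1 B2 le.
have ReQ : complex.Re (ip G.2 b - ip G.1 a) = 0.
  by apply: (eq0_of_bound S0) => t eps t0 e0; have [] := key t eps t0 e0.
have ImQ : complex.Im (ip G.2 b - ip G.1 a) = 0.
  by apply: (eq0_of_bound S0) => t eps t0 e0; have [] := key t eps t0 e0.
by apply/subr0_eq/eqP; rewrite eq_complex ReQ ImQ !eqxx.
Qed.

Definition max_graph : set (Cochains R K * Cochains R K) :=
  [set p | [/\ H p.1, H p.2 & p.2 = D p.1]].

Lemma hilbert_antisym p : H p -> antisym p.2.
Proof. by move=> /hilbert_sumE[]. Qed.

(** Here [D x] is a formal image, not known in advance to lie in [H]; this is why [antisym_eq]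
    compares antisymmetric pairs rather than elements of [H]. *)
Lemma max_graph_of_dual x y : H x -> H y ->
  (forall u, dom u -> ip (D u) x = ip u y) -> y = D x.
Proof.
move=> Hx Hy dual; apply: antisym_eq => [||u du].
- exact: hilbert_antisym.
- exact: differential_antisym.
rewrite ip_conj -dual// gauss_bonnet_green//; last exact: hilbert_antisym.
by rewrite -ip_conj.
Qed.

(** For each [u] in the domain, symmetry against [u] passes to the limit by [graph_closure_dual]
    with [b = u] and [a = D u]; the resulting identities determine [G.2]. *)
Lemma graph_closure_max G : graph_closure H ip (op_graph dom D) G -> max_graph G.
Proof.
move=> clp; have [H1 H2 _] := clp; split=> //; apply: max_graph_of_dual => // u du.
have Hu := dom_hilbert du; have HDu := dom_hilbert (gauss_bonnet_dom du).
rewrite [LHS]ip_conj [RHS]ip_conj; congr conjc; apply/esym.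
apply: (graph_closure_dual clp) => // v dv.
by apply: gauss_bonnet_green => //; exact: hilbert_antisym.
Qed.

(** The completeness bound sums over all edges at [x], whereas the estimates below group edges by
    target only. *)
Lemma fsum_src_tgt (x : K) (a : edge K -> R) : (forall e, 0 <= a e) ->
  \sum_(e \in [set e | tgt e = x]) a e <=
  \sum_(e \in [set e | tgt e = x \/ src e = x]) a e.
Proof.
move=> a0; rewrite [leRHS](fsbigID [set e | tgt e = x])/=; last exact: hfin.
rewrite (_ : _ `&` _ = [set e | tgt e = x]); last first.
  by apply/seteqP; split=> [e []//|e ex]; split=> //; left.
by rewrite lerDl; apply: fsumr_ge0.
Qed.

(** * Approximation by cutoff functions *)

Section Cutoff.
Variables (B : nat -> set K) (chi : nat -> K -> R) (M : R).
Hypothesis B_mono : {homo B : m n / (m <= n)%N >-> m `<=` n}.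
Hypothesis B_cover : \bigcup_n B n = [set: K].
Hypothesis chi_finite : forall n, finitely_supported (chi n).
Hypothesis chi01 : forall n v, 0 <= chi n v <= 1.
Hypothesis chi1 : forall n v, B n v -> chi n v = 1.
Hypothesis M_gt0 : 0 < M.
Hypothesis chiM : forall n x, (c x)^-1 *
  \sum_(e \in [set e | tgt e = x \/ src e = x]) r e * differential (chi n) e ^+ 2 <= M.

Lemma chi_eventually1 x : exists N, forall n, (N <= n)%N -> chi n x = 1.
Proof.
have [N _ Nx] : (\bigcup_n B n) x by rewrite B_cover.
by exists N => n Nn; apply: chi1; exact: (B_mono Nn).
Qed.

Lemma chi_edge_eventually1 (e : edge K) :
  exists N, forall n, (N <= n)%N -> chi n (tgt e) = 1 /\ chi n (src e) = 1.
Proof.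
have [[N1 P1] [N2 P2]] := (chi_eventually1 (tgt e), chi_eventually1 (src e)).
by exists (maxn N1 N2) => n; rewrite geq_max => /andP[/P1 ? /P2 ?].
Qed.

(** Local finiteness makes the threshold uniform over the edges ending at [x]. *)
Lemma dchi_eventually0 x : exists N, forall n, (N <= n)%N ->
  forall e, tgt e = x -> differential (chi n) e = 0.
Proof.
apply: (@eventually_finite _ [set e | tgt e = x] (fun n e => differential (chi n) e = 0)).
  exact: finite_tgt.
move=> e; have [N NP] := chi_edge_eventually1 e; exists N => n /NP[E1 E2].
by rewrite /differential E1 E2 subrr.
Qed.

Lemma dchi_bound n x :
  \sum_(e \in [set e | tgt e = x]) r e * differential (chi n) e ^+ 2 <= c x * M.
Proof.
rewrite -ler_pdivrMl// (le_trans _ (chiM n x))// ler_pM2l ?invr_gt0//.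
by apply: fsum_src_tgt => e; rewrite mulr_ge0 ?sqr_ge0// ltW.
Qed.

(** The multiplier on edges must be invariant under reversal, or the cut-off cochain would lose its
    antisymmetry. *)
Definition edge_mean n (e : edge K) : R := (chi n (tgt e) + chi n (src e)) / 2.

Definition cutoff n p : Cochains R K :=
  (fun x => (chi n x)%:C * p.1 x, fun e => (edge_mean n e)%:C * p.2 e).

Lemma edge_mean01 n e : 0 <= edge_mean n e <= 1.
Proof.
have /andP[? ?] := chi01 n (tgt e); have /andP[? ?] := chi01 n (src e).
by rewrite /edge_mean; apply/andP; split; lra.
Qed.

Lemma cutoff_dom n p : antisym p.2 -> dom (cutoff n p).
Proof.
move=> ap; split.
- apply: sub_finite_set (chi_finite n) => x /=; apply: contra_neq => ->.
  by rewrite mul0r.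
- apply: (@sub_finite_set _ _ ([set e | chi n (tgt e) != 0] `|` [set e | chi n (src e) != 0])).
    move=> e /=; rewrite /edge_mean.
    have [->|? _] := eqVneq (chi n (tgt e)) 0; last by left.
    have [->|? _] := eqVneq (chi n (src e)) 0; last by right.
    by rewrite addr0 mul0r mul0r eqxx.
  rewrite finite_setU; split.
    exact: (@finite_tgt_preimage [set x | chi n x != 0] (chi_finite n)).
  exact: (@finite_src_preimage [set x | chi n x != 0] (chi_finite n)).
- move=> e; rewrite /= ap mulrN /edge_mean; congr (- (_%:C * _)); congr (_ / _).
  by rewrite addrC.
Qed.

Lemma vanishing_sub_cutoff p : H p -> vanishing (fun n => norm2 (p - cutoff n p)).
Proof.
move=> /hilbert_sumE[l1 _ l2]; rewrite /norm2; apply: vanishingD; last first.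
  apply: (@vanishing_le _ 1 (fun n => wnorm2 r (fun e => (1 - edge_mean n e)%:C * p.2 e))) => //.
    move=> n; rewrite mul1r.
    rewrite (_ : (p - cutoff n p).2 = fun e => (1 - edge_mean n e)%:C * p.2 e).
      have := wnorm2_ge0 r_gt0 (fun e => (1 - edge_mean n e)%:C * p.2 e); lra.
    apply/funext => e; rewrite -[LHS]/(p.2 e - (edge_mean n e)%:C * p.2 e).
    by rewrite rmorphB mulrBl rmorph1 mul1r.
  apply: vanishing_cutoff => // [n e|e].
    by have /andP[? ?] := edge_mean01 n e; apply/andP; split; lra.
  have [N NP] := chi_edge_eventually1 e; exists N => n /NP[E1 E2].
  by rewrite /edge_mean E1 E2; lra.
apply: (@vanishing_le _ 1 (fun n => wnorm2 c (fun x => (1 - chi n x)%:C * p.1 x))) => //.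
  move=> n; rewrite mul1r.
  rewrite (_ : (p - cutoff n p).1 = fun x => (1 - chi n x)%:C * p.1 x)//.
  apply/funext => x; rewrite -[LHS]/(p.1 x - (chi n x)%:C * p.1 x).
  by rewrite rmorphB mulrBl rmorph1 mul1r.
apply: vanishing_cutoff => // [n x|x].
  by have /andP[? ?] := chi01 n x; apply/andP; split; lra.
by have [N NP] := chi_eventually1 x; exists N => n /NP ->; rewrite subrr.
Qed.

(** * Commutators of the operator with the cutoff *)

Definition tgt_error n (f : Cochain0 R K) : Cochain1 R K :=
  fun e => - ((differential (chi n) e)%:C * f (tgt e)).

Definition codifferential_error n (phi : Cochain1 R K) : Cochain0 R K := fun x =>
  ((2 * c x)^-1)%:C *
  \sum_(e \in [set e | tgt e = x]) ((r e)%:C * (differential (chi n) e)%:C * phi e : R[i]).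

(* Splitting d(chi f) asymmetrically, as chi(e-) df + f(e+) dchi, leaves an error
   that depends on f at the target only and can be summed vertex by vertex. *)
Lemma differential_cutoff n (f : Cochain0 R K) e :
  differential f e - differential (fun x => (chi n x)%:C * f x : R[i]) e =
  (1 - chi n (src e))%:C * differential f e + tgt_error n f e.
Proof. by rewrite /tgt_error /differential !rmorphB rmorph1; ring. Qed.

(** On an edge ending at [x], 1 minus the mean of [chi n] over the ends is [1 - chi n x] plus half
    of the differential of [chi n]; hence the factor 2 in [codifferential_error]. *)
Lemma codifferential_cutoff n (phi : Cochain1 R K) x :
  codifferential c r phi x - codifferential c r (fun e => (edge_mean n e)%:C * phi e) x =
  (1 - chi n x)%:C * codifferential c r phi x + codifferential_error n phi x.
Proof.
rewrite /codifferential /codifferential_error.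
rewrite !fsbig_finite; [|exact: finite_tgt..].
have -> : ((2 * c x)^-1)%:C = (c x)^-1%:C * 2^-1 :> R[i].
  by rewrite -real_complex_half -rmorphM [in RHS]mulrC invfM.
set S1 := \sum_(e <- _) _ * _; set S2 := \sum_(e <- _) _ * (_ * _).
set S3 := \sum_(e <- _) _.
suff E : S1 - S2 = (1 - chi n x)%:C * S1 + 2^-1 * S3.
  by rewrite -mulrBr E; ring.
rewrite /S1 /S2 /S3 !mulr_sumr -big_split -sumrB; apply: eq_big_seq => e.
rewrite in_fset_set; last exact: finite_tgt.
rewrite inE /= => ex; rewrite /edge_mean /differential ex.
rewrite real_complex_mean !rmorphB rmorph1.
by field.
Qed.

(** When the squared norm is grouped by targets, the value of [f] factors out of each fiber sum, and
    what remains is at most [c x * M]. The dominating family is [M] times that of the norm of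
    [f]. *)
Lemma vanishing_tgt_error (f : Cochain0 R K) : wl2 c f ->
  (forall n, wl2 r (tgt_error n f)) /\ vanishing (fun n => wnorm2 r (tgt_error n f)).
Proof.
move=> lf.
pose g n x := sqn (f x) * \sum_(e \in [set e | tgt e = x]) r e * differential (chi n) e ^+ 2.
have gE n : g n = fun x => \sum_(e \in [set e | tgt e = x]) r e * sqn (tgt_error n f e).
  apply/funext => x; rewrite /g !fsbig_finite; [|exact: finite_tgt..].
  rewrite mulr_sumr; apply: eq_big_seq => e.
  rewrite in_fset_set; last exact: finite_tgt.
  by rewrite inE /= => <-; rewrite /tgt_error sqnN sqnM sqnR; ring.
have g0 n x : 0 <= g n x by rewrite gE; apply: fsumr_ge0 => e _; exact: wsqn_ge0.
have gle n x : g n x <= M * (c x * sqn (f x)).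
  rewrite /g (_ : M * _ = sqn (f x) * (c x * M)); last by ring.
  by rewrite ler_wpM2l ?sqn_ge0//; exact: dchi_bound.
have sM := rsummableZ M lf.
have sg n : rsummable (g n).
  by apply: (rsummable_le _ sM) => x; rewrite ger0_norm.
have le n : wl2 r (tgt_error n f).
  have := sg n; rewrite gE => sgn.
  apply/(rsummable_fiber_ge0 finite_tgt) => // e; exact: wsqn_ge0.
split=> //; apply: (@vanishing_le _ 1 (fun n => rsum (g n))) => //.
  move=> n; rewrite mul1r gE /wnorm2 -[leLHS](rsum_fiber_ge0 finite_tgt)//.
    by move=> e; exact: wsqn_ge0.
  exact: le.
apply: (dominated_rsum sM) => [n x|x]; first by rewrite g0 gle.
have [N NP] := dchi_eventually0 x; exists N => n /NP E.
by rewrite /g fsbig1 ?mulr0// => e /= /E ->; rewrite expr0n mulr0.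
Qed.

Lemma vanishing_codifferential_error (phi : Cochain1 R K) : wl2 r phi ->
  (forall n, wl2 c (codifferential_error n phi)) /\
  vanishing (fun n => wnorm2 c (codifferential_error n phi)).
Proof.
move=> lphi.
(* The constant collects the weight [c x], the squared factor [(2 * c x)^-1] and the Cauchy-Schwarz
   bound [c x * M]; all powers of [c x] cancel. *)
pose h x := (M / 4) * \sum_(e \in [set e | tgt e = x]) r e * sqn (phi e).
have sh : rsummable h.
  apply: rsummableZ; apply/(rsummable_fiber_ge0 finite_tgt) => // e; exact: wsqn_ge0.
have le n x : c x * sqn (codifferential_error n phi x) <= h x.
  have cM : 0 < c x * M by rewrite mulr_gt0.
  have := dchi_bound n x; rewrite /h /codifferential_error sqnM sqnR.
  rewrite !fsbig_finite; [|exact: finite_tgt..].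
  set s := finmap.enum_fset _ => dle.
  (* The differential of [chi n] is real, so the real inequality applies to each component of
     [phi]. *)
  have ReS := weighted_cauchy_schwarz (fun e => complex.Re (phi e)) r_gt0 cM dle.
  have ImS := weighted_cauchy_schwarz (fun e => complex.Im (phi e)) r_gt0 cM dle.
  have sS : sqn (\sum_(e <- s) (r e)%:C * (differential (chi n) e)%:C * phi e) <=
      c x * M * \sum_(e <- s) r e * sqn (phi e).
    rewrite /sqn (raddf_sum (@complex.Re R : Rcomplex R -> R)).
    rewrite (raddf_sum (@complex.Im R : Rcomplex R -> R)).
    under [in leRHS]eq_bigr do rewrite mulrDr.
    rewrite big_split mulrDr lerD//; [apply: le_trans ReS|apply: le_trans ImS];
      rewrite le_eqVlt; apply/orP; left; apply/eqP; congr (_ ^+ 2);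
      by apply: eq_bigr => e _; case: (phi e) => a b /=; ring.
  have -> : M / 4 * \sum_(e <- s) r e * sqn (phi e) =
      (4 * c x)^-1 * (c x * M * \sum_(e <- s) r e * sqn (phi e)).
    by field; rewrite gt_eqF.
  rewrite mulrA (_ : c x * _ = (4 * c x)^-1); last by field; rewrite gt_eqF.
  by rewrite ler_wpM2l// invr_ge0 mulr_ge0// ltW.
split=> [n|].
  by apply: (rsummable_le _ sh) => x; rewrite ger0_norm ?wsqn_ge0.
apply: (dominated_wnorm2 c_gt0 sh) => // x.
have [N NP] := dchi_eventually0 x; exists N => n /NP E.
rewrite /codifferential_error fsbig1 ?mulr0// => e /= /E ->.
by rewrite mulr0 mul0r.
Qed.

Lemma vanishing_sub_gauss_bonnet_cutoff p : H p -> H (D p) ->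
  vanishing (fun n => norm2 (D p - D (cutoff n p))).
Proof.
move=> /hilbert_sumE[l1 _ l2] /hilbert_sumE[d1 _ d2].
have [e1 v1] := vanishing_tgt_error l1.
have [e2 v2] := vanishing_codifferential_error l2.
have cut01 n x : 0 <= 1 - chi n x <= 1.
  by have /andP[? ?] := chi01 n x; apply/andP; split; lra.
have cut0 x : exists N, forall n, (N <= n)%N -> 1 - chi n x = 0.
  by have [N NP] := chi_eventually1 x; exists N => n /NP ->; rewrite subrr.
have w1 := vanishing_cutoff c_gt0 d1 cut01 cut0.
have w2 := vanishing_cutoff r_gt0 d2 (fun n e => cut01 n (src e)) (fun e => cut0 (src e)).
(* The factor 2 comes from bounding the squared norm of a sum of two terms; the one half in the edge
   norm is simply bounded by 1. *)
apply: (vanishing_le (k := 2) _ _ (vanishingD (vanishingD w1 v2) (vanishingD w2 v1))) => //.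
move=> n; rewrite /norm2.
rewrite (_ : (D p - D (cutoff n p)).1 =
    (fun x => (1 - chi n x)%:C * (D p).1 x) \+ codifferential_error n p.2); last first.
  by apply/funext => x; exact: codifferential_cutoff.
rewrite (_ : (D p - D (cutoff n p)).2 =
    (fun e => (1 - chi n (src e))%:C * (D p).2 e) \+ tgt_error n p.1); last first.
  by apply/funext => e; exact: differential_cutoff.
have A := wnorm2D_le c_gt0 (wl2_cutoff c_gt0 d1 (cut01 n)) (e2 n).
have C := wnorm2D_le r_gt0 (wl2_cutoff r_gt0 d2 (fun e => cut01 n (src e))) (e1 n).
have := wnorm2_ge0 r_gt0 ((fun e => (1 - chi n (src e))%:C * (D p).2 e) \+ tgt_error n p.1).
by lra.
Qed.

(** * Density, closure and self-adjointness *)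

Lemma dense_dom : dense_in_space H ip dom.
Proof.
split=> [|p Hp _ /positive_realC[e e0 ->]]; first exact: dom_hilbert.
have [N NP] := vanishing_sub_cutoff Hp e0.
exists (cutoff N p); first by apply: cutoff_dom; exact: hilbert_antisym.
by rewrite ip_self ltcR NP.
Qed.

Lemma max_closure : max_graph `<=` graph_closure H ip (op_graph dom D).
Proof.
move=> [p q] [/= Hp Hq E]; split=> //= _ /positive_realC[e e0 ->].
rewrite E in Hq *.
have [N NP] := vanishingD (vanishing_sub_cutoff Hp) (vanishing_sub_gauss_bonnet_cutoff Hp Hq) e0.
exists (cutoff N p, D (cutoff N p)).
  by exists (cutoff N p) => //; apply: cutoff_dom; exact: hilbert_antisym.
by rewrite /= !ip_self -rmorphD ltcR NP.
Qed.

Lemma graph_closureE : graph_closure H ip (op_graph dom D) = max_graph.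
Proof. by apply/seteqP; split=> p; [exact: graph_closure_max|exact: max_closure]. Qed.

Lemma max_graph_dom u : dom u -> max_graph (u, D u).
Proof.
by move=> du; split=> //; apply: dom_hilbert => //; exact: gauss_bonnet_dom.
Qed.

Lemma gauss_bonnet_essentially_selfadjoint : essentially_selfadjoint H ip dom D.
Proof.
split; [exact: gauss_bonnet_linear|exact: dense_dom| |].
  by move=> u v du [_ _ av]; exact: gauss_bonnet_green.
rewrite graph_closureE; split.
- by move=> x y z [_ _ /= ->] [_ _ /= ->].
- split=> [_ [p [? _ _] <-] //|x Hx eps eps0].
  have [u du ?] := dense_dom.2 x Hx eps eps0.
  by exists u => //; exists (u, D u) => //; exact: max_graph_dom.
(* An adjoint pair tested on the domain alone already satisfies [p.2 = D p.1]. Conversely, any [q]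
   in [max_graph] is in the closure, so the relation against [p] extends from the domain to [q]. *)
apply/seteqP; split=> p.
  move=> [H1 H2 adj]; split=> //; apply: max_graph_of_dual => // u du.
  exact: (adj _ (max_graph_dom du)).
move=> [H1 H2 pE]; split=> // q /max_closure clq.
apply: (graph_closure_dual clq) => // u du; rewrite pE.
by apply: gauss_bonnet_green => //; exact: hilbert_antisym.
Qed.

End Cutoff.
End GaussBonnet.

Theorem theorem1 (R : realType) (K : graph) (c : K -> R) (r : edge K -> R)
    (hconn : connected_graph K) (hfin : locally_finite K)
    (c_gt0 : forall v : K, 0 < c v)
    (r_gt0 : forall e : edge K, 0 < r e)
    (r_sym : forall e : edge K, r (opp_edge e) = r e)
    (hchi : chi_complete c r) :
  essentially_selfadjoint (hilbert_sum c r) (ip_sum c r)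
    (@gauss_bonnet_domain R K) (gauss_bonnet c r).
Proof.
have [B [chi [[_ B_mono B_cover] chi_prop chi1 [M M_gt0 chiM]]]] := hchi.
apply: (gauss_bonnet_essentially_selfadjoint hfin c_gt0 r_gt0 r_sym B_mono B_cover
  _ _ chi1 M_gt0 chiM) => n; by have [] := chi_prop n.
Qed.
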